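(* Suppose $G$ is a finite group and $\Bbbk$ is an algebraically closed field of characteristic $p$, where $p$ divides $|G|$. Let $P$ be a Sylow-$p$-subgroup of $G$, let $N_G(P)$ be its normalizer in $G$, and let $l$ denote the smallest prime divisor of $|G|$. Then the following holds: (a) If $\sigma(G)=|G|$, then $N_G(P)/P$ is a cyclic group. If additionally $P$ is abelian and $G\neq P$, then $N_G(P)/P$ is also non-trivial. (b) If $N_G(P)/P$ is cyclic, then $\sigma(G)\ge|N_G(P)|$. In particular $\sigma(G)=|G|$ when $P$ is normal in $G$ and $G/P$ is cyclic. (c) If $G$ is $p$-nilpotent and $P$ is not normal in $G$, then $\sigma(G)\le\frac{|G|}{l}$.
   Context: A $G$-module is a finite dimensional representation $V$ of $G$ over $\Bbbk$. $\Bbbk[V]$ is the ring of polynomial functions $V\to\Bbbk$, with action $(g\cdot f)(v)=f(g^{-1}v)$, and $\Bbbk[V]^G$ is its graded subring of invariants. $\Bbbk[V]^G_{\le d}$ is the set of invariants of degree at most $d$ (including $0$). For $S\subseteq\Bbbk[V]$, $S_+$ denotes the set of elements of $S$ with constant term zero. The nullcone is $\mathcal{N}_{G,V}=\{v\in V : f(v)=0 \text{ for all } f\in\Bbbk[V]^G_+\}$. A subset $S\subseteq\Bbbk[V]^G$ is a $\sigma$-set if for all $v\in V\setminus\mathcal{N}_{G,V}$ there is $f\in S_+$ with $f(v)\neq0$. Then $\sigma(G,V)=\min\{d\ge0 : \Bbbk[V]^G_{\le d}\text{ is a }\sigma\text{-set}\}$ and $\sigma(G)=\sup\{\sigma(G,V)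 : V\text{ a }G\text{-module}\}$. (For finite $G$, $\mathcal{N}_{G,V}=\{0\}$.) A finite group $G$ is $p$-nilpotent if a Sylow-$p$-subgroup $P$ has a normal complement, i.e. there is $H\unlhd G$ with $G=PH$ and $P\cap H$ trivial. *)

(* Defs.v *)
From HB Require Import structures.
From mathcomp Require Import all_boot all_fingroup all_algebra all_solvable.
From mathcomp Require Import all_character.
From mathcomp Require Import boolp mpoly.

Set Implicit Arguments.
Unset Strict Implicit.
Unset Printing Implicit Defensive.

Import GroupScope GRing.Theory.
Local Open Scope ring_scope.

(* A G-module of dimension n is a matrix representation [rG] of G of degree n,
   with g in G acting on V = 'cV[k]_n by v |-> rG g *m v. Since k is infinite
   wherever these notions are used, k[V] is identified with {mpoly k[n]}. *)

Section Invariants.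
Variables (k : fieldType) (gT : finGroupType) (G : {group gT}) (n : nat).
Variable rG : mx_representation k G n.
Implicit Types (g : gT) (f : {mpoly k[n]}) (v : 'cV[k]_n).

Definition evalV f v : k := f.@[fun i => v i ord0].

(* Substitutes for 'X_i the i-th coordinate of rG g^-1 *m v, so that
   (g . f)(v) = f(g^-1 v): see [evalV_actp]. *)
Definition actp g f : {mpoly k[n]} :=
  f \mPo [tuple \sum_(j < n) rG g^-1%g i j *: 'X_j | i < n].

Lemma evalV_actp g f v : evalV (actp g f) v = evalV f (rG g^-1%g *m v).
Proof.
rewrite /evalV /actp comp_mpoly_meval; apply: meval_eq => i.
rewrite tnth_mktuple mxE raddf_sum; apply: eq_bigr => j _.
by rewrite /= mevalZ mevalXU.
Qed.

Lemma evalV0 f : evalV f 0 = f@_0%MM.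
Proof.
rewrite /evalV [in LHS](mpolyE f) raddf_sum /=.
have cst m : (f@_m *: 'X_[m]).@[fun i => (0 : 'cV[k]_n) i ord0]
             = f@_m *+ (m == 0%MM).
  rewrite mevalZ mevalX; have [->|m0] := eqVneq m 0%MM.
    by rewrite big1 ?mulr1 // => i _; rewrite mnm0E expr0.
  have [i mi] : exists i, m i != 0%N.
    apply/existsP; apply: contraNT m0; rewrite negb_exists => /forallP m0.
    by apply/eqP/mnmP => i; rewrite mnm0E; apply/eqP; have := m0 i; rewrite negbK.
  by rewrite (bigD1 i) //= mxE expr0n (negbTE mi) mul0r mulr0 mulr0n.
under eq_bigr => m _ do rewrite cst.
have [f0|f0] := boolP (0%MM \in msupp f); last first.
  rewrite (memN_msupp_eq0 f0) big_seq big1 // => m mf.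
  by rewrite (negbTE (memPn f0 m mf)) mulr0n.
rewrite (bigD1_seq 0%MM) ?msupp_uniq //= eqxx mulr1n big1 ?addr0 // => m.
by move=> /negbTE ->.
Qed.

Definition invariant f : Prop := forall g, g \in G -> actp g f = f.

(* [msize f] is deg f + 1, and 0 for f = 0. *)
Definition invariant_le (d : nat) f : Prop :=
  invariant f /\ (msize f <= d.+1)%N.

Definition plus (S : {mpoly k[n]} -> Prop) f : Prop := S f /\ f@_0%MM = 0.

Definition nullcone v : Prop := forall f, plus invariant f -> evalV f v = 0.

Definition sigma_set (S : {mpoly k[n]} -> Prop) : Prop :=
  (forall f, S f -> invariant f) /\
  (forall v, ~ nullcone v -> exists2 f, plus S f & evalV f v != 0).

End Invariants.

Section Sigma.
Variables (k : closedFieldType) (gT : finGroupType) (G : {group gT}).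

Section Module.
Variables (n : nat) (rG : mx_representation k G n).

Definition linform (c : 'rV[k]_n) : {mpoly k[n]} := \sum_(j < n) c 0 j *: 'X_j.

Lemma evalV_linform c (v : 'cV[k]_n) : evalV (linform c) v = (c *m v) 0 0.
Proof.
rewrite /evalV /linform raddf_sum mxE; apply: eq_bigr => j _.
by rewrite /= mevalZ mevalXU.
Qed.

Lemma actp_linform g c : actp rG g (linform c) = linform (c *m rG g^-1%g).
Proof.
rewrite /actp /linform raddf_sum /=.
under eq_bigr => j _.
  rewrite comp_mpolyZ comp_mpolyXU -tnth_nth tnth_mktuple scaler_sumr.
  under eq_bigr => i _ do rewrite scalerA.
over.
rewrite exchange_big /=; apply: eq_bigr => i _.
by rewrite mxE scaler_suml.
Qed.

Lemma exists_linform (v : 'cV[k]_n) : v != 0 ->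
  exists c : 'rV[k]_n, forall g, g \in G -> (c *m rG g *m v) 0 0 != 0.
Proof.
move=> v0; pose q g : {poly k} := \sum_(i < n) ((rG g *m v) i 0) *: 'X^i.
have q0 g : g \in G -> q g != 0.
  move=> gG; apply: contra v0 => /eqP q0.
  have: rG g *m v = 0.
    apply/colP => i; rewrite [RHS]mxE; transitivity ((q g)`_i); last first.
      by rewrite q0 coef0.
    rewrite coef_sum (bigD1 i) //= coefZ coefXn eqxx mulr1 big1 ?addr0 // => j.
    by rewrite coefZ coefXn eq_sym => /negbTE ji; rewrite -val_eqE in ji;
       rewrite ji mulr0.
  by move/(congr1 (mulmx (rG g^-1%g))); rewrite mulmxA -repr_mxM ?groupV // mulVg
     repr_mx1 mul1mx mulmx0 => ->.
have: \prod_(g in G) q g != 0 by apply/prodf_neq0.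
case/closed_nonrootP => t; rewrite /root horner_prod => /prodf_neq0 qt.
exists (\row_i t ^+ i) => g gG; apply: contra (qt g gG) => /eqP e.
apply/eqP; rewrite -[RHS]e -mulmxA mxE horner_sum; apply: eq_bigr => i _.
by rewrite hornerZ hornerXn mulrC [in RHS]mxE.
Qed.

Lemma sigma_set_cardG : sigma_set rG (invariant_le rG #|G|).
Proof.
split=> [f []//|v Nv].
have v0 : v != 0.
  by apply/eqP => v0; apply: Nv => f [_ f0]; rewrite v0 evalV0.
have [c cP] := exists_linform v0.
pose f := \prod_(g in G) linform (c *m rG g^-1%g).
have evf w : evalV f w = \prod_(g in G) (c *m rG g^-1%g *m w) 0 0.
  by rewrite /evalV rmorph_prod; apply: eq_bigr => g _; rewrite -evalV_linform.
exists f; last first.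
  by rewrite evf; apply/prodf_neq0 => g gG; apply: cP; rewrite groupV.
split; last first.
  by rewrite -evalV0 evf (bigD1 1%g) //= mulmx0 mxE mul0r.
split.
  move=> h hG; rewrite /f /actp rmorph_prod /=.
  rewrite [RHS](reindex_inj (mulgI h)) /=.
  apply: eq_big => [g|g gG]; first by rewrite groupMl.
  rewrite -/(actp rG h _) actp_linform -mulmxA -repr_mxM ?groupV //.
  by rewrite invMg.
have lin d : (msize (linform d) <= 2)%N.
  apply: (leq_trans (msize_sum _ _ _)); apply/bigmax_leqP => i _.
  by apply: (leq_trans (msizeZ_le _ _)); rewrite msizeX mdeg1.
rewrite /f cardE -big_enum /=; elim: (enum G) => [|g s IH].
  by rewrite big_nil msize1.
rewrite big_cons /=; set q := \prod_(i <- s) _ in IH *.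
have [->|l0] := eqVneq (linform (c *m rG g^-1%g)) 0; first by rewrite mul0r msize0.
have [->|q0] := eqVneq q 0; first by rewrite mulr0 msize0.
rewrite msizeM //; have := leq_add (lin (c *m rG g^-1%g)) IH.
by rewrite -subn1 leq_subLR add1n !addSn add0n.
Qed.

Lemma sigma_set_ex : exists d, `[< sigma_set rG (invariant_le rG d) >].
Proof. by exists #|G|; apply/asboolP/sigma_set_cardG. Qed.

Definition sigma_module : nat := ex_minn sigma_set_ex.

Lemma sigma_module_le : (sigma_module <= #|G|)%N.
Proof.
rewrite /sigma_module; case: ex_minnP => d _; apply.
exact/asboolP/sigma_set_cardG.
Qed.

End Module.

Lemma sigma_module_bounded :
  exists m, `[< forall n (rG : mx_representation k G n),
                  (sigma_module rG <= m)%N >].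
Proof. by exists #|G|; apply/asboolP => n rG; apply: sigma_module_le. Qed.

(* The least upper bound, in nat, of all the sigma_module rG. *)
Definition sigma : nat := ex_minn sigma_module_bounded.

End Sigma.

Arguments sigma k {gT} G.

Definition p_nilpotent (p : nat) (gT : finGroupType) (G : {group gT}) : Prop :=
  exists P H : {group gT},
    [/\ p.-Sylow(G) P, H <| G, (P * H)%g = G & P :&: H = 1%g].

(* Main.v *)
Require Import Defs.
From mathcomp Require Import all_boot all_fingroup all_algebra all_solvable.
From mathcomp Require Import all_character all_field.
From mathcomp Require Import boolp mpoly zify.

(** Say that v is d-separated by A when some A-invariant polynomial of degree
    at most d vanishes at 0 but not at v; then sigma k G is the least d such
    that every nonzero vector of every G-module is d-separated by G.  So each
    upper bound on sigma is proved one vector at a time, and a lower bound needs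
    one vector only.

    The tool for upper bounds is [separated_nonzero_cosets]: if f is invariant
    under K, of degree d, and exactly t > 0 of its translates over the left
    cosets of K in G do not vanish at v, then the t-th elementary symmetric
    polynomial of these translates is G-invariant, has degree at most t * d, and
    does not vanish at v, because a single one of its terms survives.  With
    t <= [G : K] this passes from K to G at the cost of a factor [G : K]; with
    t = 1 it costs nothing.

    If v is not an eigenvector of G, choose g in G with g v not proportional to
    v and a linear form that vanishes at v but not at g v: at most |G| - 1 of its
    translates are nonzero at v, and v is (|G| - 1)-separated.  If v is an
    eigenvector, let K be its stabiliser, the kernel of a character of G with
    values in the units of k.  It contains P, since 1 is the only p-power root
    of unity in k.  Now v is |P|-separated by P; summing translates over K / P,
    whose order is invertible in k, it is also |P|-separated by K, hence
    ([G : K] * |P|)-separated by G, and this degree is smaller than |G| unless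
    K = P.  So sigma k G = |G| forces P to be
    normal with G / P embedded in the units of k, thus cyclic; this gives (a) in
    a stronger form.

    For (b), put N := N_G(P), let chi be a faithful character of N / P, and let
    v be chi on N extended by 0, as a vector of the permutation module of
    functions on the group.  Let f be an invariant and a_d the value at v of its
    homogeneous part of degree d.  Moving v by N gives a_d = chi(g) ^ d * a_d,
    so [N : P] divides d if a_d != 0.  In a_d the monomials with a nontrivial
    P-orbit cancel in characteristic p, and a P-invariant exponent is constant on
    the cosets of P, so |P| divides d as well.  Hence |N| divides d.

    For (c), let H be the normal p-complement.  As P is not normal, some x in P
    does not centralise H, so it normalises without centralising some Sylow
    q-subgroup Q of H.  If Q is not cyclic, then Q / Phi(Q) is elementary
    abelian of order at least q ^ 2, and the q-th power of a Phi(Q)-invariant of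
    degree at most |Phi(Q)| that is an eigenvector of Q separates in degree at
    most |Q| / q.  If Q is cyclic, x acts nontrivially on its subgroup <z> of
    order q; replace x by a power such that x ^ p commutes with z.  Let c be a
    <x ^ p>-invariant eigenvector of z with c(v) != 0.  If z fixes c, the
    index bound suffices.  Otherwise the translates c_i of c under x ^ i, for
    i < p, are eigenvectors of z with pairwise distinct weights, and a
    suitable monomial of degree at most q in those that do not vanish at v
    yields an invariant of <z, x> of degree at most q * |<x ^ p>|, which is
    |<z, x>| / p. *)

Set Implicit Arguments.
Unset Strict Implicit.
Unset Printing Implicit Defensive.

Import GroupScope GRing.Theory.

(** * The action on polynomials, and degrees *)

Section PolynomialAction.
Local Open Scope ring_scope.
Variables (k : closedFieldType) (gT : finGroupType) (G : {group gT}) (n : nat).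
Variable rG : mx_representation k G n.
Implicit Types (g h : gT) (f : {mpoly k[n]}) (v : 'cV[k]_n) (K : {group gT}).

Lemma evalVD v : {morph (fun f => evalV f v) : f f' / f + f'}.
Proof. by move=> f f'; rewrite /evalV mevalD. Qed.

Lemma evalVZ v c f : evalV (c *: f) v = c * evalV f v.
Proof. by rewrite /evalV mevalZ. Qed.

Lemma evalVX v f m : evalV (f ^+ m) v = evalV f v ^+ m.
Proof. by rewrite /evalV rmorphXn. Qed.

Lemma evalV_sum v (I : Type) (r : seq I) (Q : pred I) F :
  evalV (\sum_(i <- r | Q i) F i) v = \sum_(i <- r | Q i) evalV (F i) v.
Proof. by rewrite /evalV rmorph_sum. Qed.

Lemma evalV_prod v (I : Type) (r : seq I) (Q : pred I) F :
  evalV (\prod_(i <- r | Q i) F i) v = \prod_(i <- r | Q i) evalV (F i) v.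
Proof. by rewrite /evalV rmorph_prod. Qed.

Lemma evalV_prod_eq0 v (I : finType) (Q : pred I) F i :
  Q i -> evalV (F i) v = 0 -> evalV (\prod_(j | Q j) F j) v = 0.
Proof. by move=> Qi Fi; rewrite evalV_prod (bigD1 i Qi) /= Fi mul0r. Qed.

Lemma evalVX_eq0 v f m : (0 < m)%N -> evalV f v = 0 -> evalV (f ^+ m) v = 0.
Proof. by move=> m_gt0 fv; rewrite evalVX fv expr0n eqn0Ngt m_gt0. Qed.

Lemma actpZ g c f : actp rG g (c *: f) = c *: actp rG g f.
Proof. by rewrite /actp linearZ. Qed.

Lemma actpX g f m : actp rG g (f ^+ m) = actp rG g f ^+ m.
Proof. by rewrite /actp rmorphXn. Qed.

Lemma actp_sum g (I : Type) (r : seq I) (Q : pred I) F :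
  actp rG g (\sum_(i <- r | Q i) F i) = \sum_(i <- r | Q i) actp rG g (F i).
Proof. by rewrite /actp raddf_sum. Qed.

Lemma actp_prod g (I : Type) (r : seq I) (Q : pred I) F :
  actp rG g (\prod_(i <- r | Q i) F i) = \prod_(i <- r | Q i) actp rG g (F i).
Proof. by rewrite /actp rmorph_prod. Qed.

Lemma actp_mnm g (m : 'X_{1..n}) :
  actp rG g 'X_[m] = \prod_(i < n) linform (row i (rG g^-1%g)) ^+ m i.
Proof.
rewrite /actp comp_mpolyX; apply: eq_bigr => i _; congr (_ ^+ _).
by rewrite tnth_mktuple /linform; apply: eq_bigr => j _; rewrite mxE.
Qed.

Lemma actp1 f : actp rG 1 f = f.
Proof.
rewrite [in LHS](mpolyE f) [in RHS](mpolyE f) actp_sum.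
apply: eq_bigr => m _; rewrite actpZ actp_mnm mpolyXE_id; congr (_ *: _).
apply: eq_bigr => i _; congr (_ ^+ _); rewrite invg1 repr_mx1 /linform.
rewrite (bigD1 i) //= !mxE eqxx scale1r big1 ?addr0 // => j /negbTE ji.
by rewrite !mxE eq_sym ji scale0r.
Qed.

(** Both sides are algebra morphisms in f, so that it suffices to compare them on
    the coordinates, which are linear forms. *)
Lemma actpM g h f : g \in G -> h \in G ->
  actp rG (g * h)%g f = actp rG g (actp rG h f).
Proof.
move=> gG hG; rewrite [in LHS](mpolyE f) [in actp rG h _](mpolyE f).
rewrite [LHS]actp_sum [in actp rG h _]actp_sum [RHS]actp_sum.
apply: eq_bigr => m _; rewrite !actpZ !actp_mnm actp_prod; congr (_ *: _).
apply: eq_bigr => i _; rewrite actpX actp_linform; congr (linform _ ^+ _).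
by rewrite invMg repr_mxM ?groupV // row_mul.
Qed.

Lemma msize_sum_le (I : Type) (r : seq I) (Q : pred I) (F : I -> {mpoly k[n]}) d :
  (forall i, Q i -> msize (F i) <= d)%N ->
  (msize (\sum_(i <- r | Q i) F i) <= d)%N.
Proof.
move=> Fd; elim/big_rec: _ => [|i f Qi fd]; first by rewrite msize0.
by rewrite (leq_trans (msizeD_le _ _)) // geq_max Fd.
Qed.

(** In terms of degrees, degree at most d is the bound [msize f <= d.+1]; it also
    covers the zero polynomial, for which the degree formula of a product fails. *)
Lemma msizeM_leD f f' d d' :
  (msize f <= d.+1 -> msize f' <= d'.+1 -> msize (f * f') <= (d + d').+1)%N.
Proof.
have [->|f0] := eqVneq f 0; first by rewrite mul0r msize0.
have [->|f'0] := eqVneq f' 0; first by rewrite mulr0 msize0.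
move=> fd fd'; rewrite msizeM // -ltnS prednK ?(leq_trans (leq_add fd fd')) //.
  by rewrite addSn addnS.
by rewrite addn_gt0 lt0n msize_poly_eq0 f0.
Qed.

Lemma msize_prod_le (I : Type) (r : seq I) (Q : pred I) (F : I -> {mpoly k[n]}) d :
  (forall i, Q i -> msize (F i) <= (d i).+1)%N ->
  (msize (\prod_(i <- r | Q i) F i) <= (\sum_(i <- r | Q i) d i).+1)%N.
Proof.
move=> Fd; elim/big_rec2: _ => [|i d' f Qi fd]; first by rewrite msize1.
by rewrite msizeM_leD ?Fd.
Qed.

Lemma msizeX_le f d m : (msize f <= d.+1 -> msize (f ^+ m) <= (m * d).+1)%N.
Proof.
move=> fd; elim: m => [|m IH]; first by rewrite expr0 msize1.
by rewrite exprS mulSn msizeM_leD.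
Qed.

Lemma msize_linform (c : 'rV[k]_n) : (msize (linform c) <= 2)%N.
Proof.
apply: msize_sum_le => i _.
by rewrite (leq_trans (msizeZ_le _ _)) // msizeX mdeg1.
Qed.

Lemma msize_actp g f : (msize (actp rG g f) <= msize f)%N.
Proof.
rewrite [in actp _ _ _](mpolyE f) actp_sum big_seq_cond; apply: msize_sum_le => m.
rewrite andbT actpZ actp_mnm => mf; apply: leq_trans (msizeZ_le _ _) _.
apply: leq_trans (msize_mdeg_lt mf); rewrite mdegE.
apply: msize_prod_le => i _.
by have := msizeX_le (m i) (msize_linform (row i (rG g^-1%g))); rewrite muln1.
Qed.

End PolynomialAction.

(** * Separation by invariants and elementary symmetric polynomials of translates *)

Section Separation.
Local Open Scope ring_scope.
Variables (k : closedFieldType) (gT : finGroupType) (G : {group gT}) (n : nat).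
Variable rG : mx_representation k G n.
Implicit Types (g h : gT) (f : {mpoly k[n]}) (v : 'cV[k]_n) (K : {group gT}).

Definition fixes (A : {set gT}) f : Prop := forall g, g \in A -> actp rG g f = f.

Definition separated (A : {set gT}) (d : nat) v : Prop :=
  exists f, [/\ fixes A f, (msize f <= d.+1)%N, evalV f 0 = 0 & evalV f v != 0].

Lemma separated_leq (A : {set gT}) d d' v :
  (d <= d')%N -> separated A d v -> separated A d' v.
Proof.
by move=> le_dd' [f [fA fd f0 fv]]; exists f; split=> //; apply: leq_trans fd _.
Qed.

Lemma evalV_actp0 g f : evalV (actp rG g f) 0 = evalV f 0.
Proof. by rewrite evalV_actp mulmx0. Qed.

Section Cosets.
Variables (K : {group gT}) (f : {mpoly k[n]}).
Hypotheses (sKG : K \subset G) (fK : fixes K f).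

(** By invariance of f under K, this is g . f for any g in C: see [translateE]. *)
Definition translate (C : {set gT}) : {mpoly k[n]} := actp rG (repr C) f.

Lemma translateE g : g \in G -> translate (g *: K)%g = actp rG g f.
Proof.
move=> gG; rewrite /translate.
have /lcosetP[y yK ->] := mem_repr g (lcoset_refl K g).
by rewrite actpM // ?(subsetP sKG) // fK.
Qed.

Lemma actp_translate g C :
  g \in G -> C \in lcosets K G -> actp rG g (translate C) = translate (g *: C)%g.
Proof.
move=> gG /lcosetsP[x xG ->].
by rewrite -lcosetM !translateE ?groupM // actpM.
Qed.

(** The j-th elementary symmetric polynomial of the translates of f, indexed by
    cosets so that translates that happen to coincide count separately. *)
Definition relsym (j : nat) : {mpoly k[n]} :=
  \sum_(S : {set {set gT}} | (S \subset lcosets K G) && (#|S| == j))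
    \prod_(C in S) translate C.

Lemma relsym_fixed j : fixes G (relsym j).
Proof.
move=> g gG; rewrite /relsym actp_sum.
have lg_inj : injective (fun C : {set gT} => g *: C)%g := can_inj (lcosetK g).
have lgX h C : h \in G -> C \in lcosets K G -> (h *: C)%g \in lcosets K G.
  move=> hG /lcosetsP[x xG ->].
  by rewrite -lcosetM; apply/lcosetsP; exists (h * x)%g; rewrite ?groupM.
rewrite [RHS](reindex_inj (imset_inj lg_inj)) /=.
apply: eq_big => [S|S /andP[/subsetP SX _]].
  rewrite card_imset //; congr (_ && _); apply/subsetP/subsetP => SX C.
    by case/imsetP=> B BS ->; rewrite lgX ?SX.
  by move=> CS; rewrite -(lcosetK g C) lgX ?groupV ?SX ?imset_f.
rewrite actp_prod big_imset /=; last by move=> C D _ _; apply: lg_inj.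
by apply: eq_bigr => C CS; rewrite actp_translate ?SX.
Qed.

Lemma msize_relsym j d : (msize f <= d.+1 -> msize (relsym j) <= (j * d).+1)%N.
Proof.
move=> fd; apply: msize_sum_le => S /andP[_ /eqP Sj].
have fd' C : C \in S -> (msize (translate C) <= d.+1)%N.
  by move=> _; apply: leq_trans (msize_actp _ _ _) fd.
by have := msize_prod_le (index_enum _) fd'; rewrite sum_nat_const Sj.
Qed.

Lemma evalV_relsym j v : evalV (relsym j) v =
  \sum_(S : {set {set gT}} | (S \subset lcosets K G) && (#|S| == j))
    \prod_(C in S) evalV (translate C) v.
Proof. by rewrite evalV_sum; apply: eq_bigr => S _; rewrite evalV_prod. Qed.

Lemma evalV_relsym0 j : (0 < j)%N -> evalV f 0 = 0 -> evalV (relsym j) 0 = 0.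
Proof.
move=> j0 f0; rewrite evalV_relsym big1 // => S /andP[_ /eqP Sj].
have /card_gt0P[C CS] : (0 < #|S|)%N by rewrite Sj.
by rewrite (bigD1 C) //= evalV_actp0 f0 mul0r.
Qed.

Definition nonzero_cosets v : {set {set gT}} :=
  [set C in lcosets K G | evalV (translate C) v != 0].

Lemma nonzero_cosetsP v : reflect
  (exists2 g, g \in G & evalV (actp rG g f) v != 0) (0 < #|nonzero_cosets v|)%N.
Proof.
apply: (iffP (card_gt0P)) => [[_ /setIdP[/lcosetsP[g gG ->]]]|[g gG fg]].
  by rewrite translateE //; exists g.
exists (g *: K)%g; rewrite inE translateE // fg andbT.
by apply/lcosetsP; exists g.
Qed.

(** Any other set of as many cosets contains one where the translate vanishes at v,
    so the only surviving term is the product of all the nonzero values. *)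
Lemma evalV_relsym_nonzero v : evalV (relsym #|nonzero_cosets v|) v != 0.
Proof.
set S0 := nonzero_cosets v; rewrite evalV_relsym (bigD1 S0) /=; last first.
  by rewrite eqxx andbT; apply/subsetP => C /setIdP[].
rewrite [X in _ + X]big1 ?addr0 => [|S /andP[/andP[SX cS] SS0]].
  by apply/prodf_neq0 => C /setIdP[].
have /subsetPn[C CS CS0] : ~~ (S \subset S0).
  by apply: contra SS0 => sSS0; rewrite eqEcard sSS0 (eqP cS) leqnn.
rewrite (bigD1 C) //=; move: CS0; rewrite inE (subsetP SX) //= negbK => /eqP ->.
by rewrite mul0r.
Qed.

Lemma separated_nonzero_cosets v d g :
    (msize f <= d.+1)%N -> evalV f 0 = 0 ->
    g \in G -> evalV (actp rG g f) v != 0 ->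
  separated G (#|nonzero_cosets v| * d) v.
Proof.
move=> fd f0 gG fg; have t0 : (0 < #|nonzero_cosets v|)%N.
  by apply/nonzero_cosetsP; exists g.
exists (relsym #|nonzero_cosets v|); split.
- exact: relsym_fixed.
- exact: msize_relsym.
- exact: evalV_relsym0.
- exact: evalV_relsym_nonzero.
Qed.

End Cosets.

Lemma separated_index K v d :
  K \subset G -> separated K d v -> separated G (#|G : K| * d) v.
Proof.
move=> sKG [f [fK fd f0 fv]].
have := separated_nonzero_cosets sKG fK fd f0 (group1 G).
rewrite actp1 => /(_ v fv); apply: separated_leq.
rewrite leq_mul2r -card_lcosets subset_leq_card ?orbT //.
by apply/subsetP => C /setIdP[].
Qed.

(** The case of a single nonzero translate: no loss in the degree. *)
Lemma separated_isolated K v d f :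
    K \subset G -> fixes K f -> (msize f <= d.+1)%N -> evalV f 0 = 0 ->
    evalV f v != 0 ->
    (forall g, g \in G -> g \notin K -> evalV (actp rG g f) v = 0) ->
  separated G d v.
Proof.
move=> sKG fK fd f0 fv iso.
have := separated_nonzero_cosets sKG fK fd f0 (group1 G).
rewrite actp1 => /(_ v fv); apply: separated_leq.
rewrite -[leqRHS]mul1n leq_mul2r -(cards1 (K : {set gT})) subset_leq_card ?orbT //.
apply/subsetP => _ /setIdP[/lcosetsP[g gG ->]]; rewrite translateE // inE => fg.
have [gK|gK] := boolP (g \in K); first by rewrite lcoset_id.
by rewrite iso ?eqxx in fg.
Qed.

(** At a fixed vector all translates take the same value, and their sum is
    [G : K] times this value. *)
Lemma separated_transfer K v d :
    K \subset G -> (#|G : K|%:R != 0 :> k) ->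
    (forall g, g \in G -> rG g *m v = v) ->
  separated K d v -> separated G d v.
Proof.
move=> sKG nzi vG [f [fK fd f0 fv]]; exists (relsym K f 1); split.
- exact: relsym_fixed.
- by rewrite -[d]mul1n msize_relsym.
- exact: evalV_relsym0.
rewrite evalV_relsym (eq_bigr (fun=> evalV f v)); last first.
  move=> S /andP[/subsetP SX /eqP S1].
  rewrite (eq_bigr (fun=> evalV f v)) ?prodr_const ?S1 ?expr1 // => C /SX.
  by case/lcosetsP=> g gG ->; rewrite translateE // evalV_actp vG ?groupV.
rewrite sumr_const -cardsE cards_draws bin1 card_lcosets -mulr_natl.
by rewrite mulf_neq0.
Qed.

End Separation.

(** * Eigenvectors of the group *)

Section Sigma.
Local Open Scope ring_scope.
Variables (k : closedFieldType) (gT : finGroupType) (G : {group gT}).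

Section Module.
Variables (n : nat) (rG : mx_representation k G n).
Implicit Types (g : gT) (f : {mpoly k[n]}) (v : 'cV[k]_n) (P : {group gT}).

Lemma evalV_linform0 (c : 'rV[k]_n) : evalV (linform c) 0 = 0.
Proof. by rewrite evalV_linform mulmx0 mxE. Qed.

Lemma fixes1 f : fixes rG 1%g f.
Proof. by move=> g /set1P ->; rewrite actp1. Qed.

(** The translates by P of a linear form that is nonzero at v provide a nonzero
    elementary symmetric polynomial of degree at most |P|. *)
Lemma separated_order P v : P \subset G -> v != 0 -> separated rG P #|P| v.
Proof.
move=> sPG v0; have [c cv] := exists_linform rG v0.
rewrite -[X in separated _ _ X]muln1 -indexg1.
apply: (separated_index (rG := subg_repr rG sPG) (sub1G P)).
exists (linform c); split; first exact: fixes1.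
- exact: msize_linform.
- exact: evalV_linform0.
by rewrite evalV_linform -[c]mulmx1 -(repr_mx1 rG) cv.
Qed.

(** A linear form that vanishes at v but not at g v has a translate that vanishes
    at v and another that does not: at most |G| - 1 of them are nonzero. *)
Lemma separated_not_eigenvector g v :
  g \in G -> ~~ ((rG g *m v)^T <= v^T)%MS -> separated rG G #|G|.-1 v.
Proof.
move=> gG; rewrite submxE => /matrix0Pn[i [j]].
rewrite ord1 => cgv; pose c := (col j (cokermx v^T))^T.
have cE (w : 'cV_n) : (c *m w) 0 0 = (w^T *m cokermx v^T) 0 j.
  rewrite -[c *m w]trmxK mxE trmx_mul trmxK [LHS]mxE [RHS]mxE.
  by apply: eq_bigr => l _; rewrite [col _ _ _ _]mxE.
have cv : (c *m v) 0 0 = 0 by rewrite cE mulmx_coker mxE.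
have fgv : evalV (actp rG g^-1%g (linform c)) v != 0.
  by rewrite evalV_actp invgK evalV_linform cE.
have f1 := fixes1 (linform c).
have := separated_nonzero_cosets (sub1G G) f1 (msize_linform c) (evalV_linform0 c).
move=> /(_ v _ (groupVr gG) fgv); apply: separated_leq; rewrite muln1.
rewrite -ltnS (ltn_predK (cardG_gt0 G)) -[in ltnRHS](indexg1 G) -card_lcosets.
apply/proper_card/properP; split; first by apply/subsetP => C /setIdP[].
exists (1 *: 1%G)%g; first by apply/lcosetsP; exists 1%g.
by rewrite inE (translateE (sub1G G) f1) // actp1 evalV_linform cv eqxx andbF.
Qed.

Section Eigenvector.
Variable v : 'cV[k]_n.
Hypotheses (v0 : v != 0) (Gv : forall g, g \in G -> ((rG g *m v)^T <= v^T)%MS).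

Lemma eigenvalue_ex : exists chi : gT -> k,
  [/\ {in G, forall g, rG g *m v = chi g *: v},
      {in G &, {morph chi : g h / (g * h)%g >-> g * h}}
    & {in G, forall g, (chi g == 1) = (rG g *m v == v)}].
Proof.
have /choice[chi chiP] : forall g, exists a, g \in G -> rG g *m v = a *: v.
  move=> g; have [gG|] := boolP (g \in G); last by exists 0.
  have /sub_rVP[a aP] := Gv gG.
  by exists a => _; apply: trmx_inj; rewrite aP linearZ.
have vI : injective (fun a => a *: v).
  move=> a b /eqP; rewrite -subr_eq0 -scalerBl scaler_eq0 (negbTE v0) orbF.
  by rewrite subr_eq0 => /eqP.
exists chi; split=> [//|g h gG hG|g gG].
  by apply: vI; rewrite -chiP ?groupM // repr_mxM // -mulmxA !chiP // -scalemxAr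
     chiP // scalerA mulrC.
by rewrite chiP // -(inj_eq vI) scale1r.
Qed.

(** The stabiliser of v is the kernel of the eigenvalue character. It contains P,
    and the degree [G : K] * |P| is smaller than |G| unless K = P, in which case
    the character embeds G / P in the units of k. *)
Lemma separated_eigenvector p P :
    p \in [pchar k] -> p.-Sylow(G) P -> ~~ ((P <| G) && cyclic (G / P)%g) ->
  separated rG G #|G|.-1 v.
Proof.
move=> pk sylP nPcyc; have [chi [chiv chiM chi1]] := eigenvalue_ex.
have sPG := pHall_sub sylP.
pose K := [set g in G | rG g *m v == v].
have gK : group_set K.
  apply/group_setP; split=> [|g h]; first by rewrite inE group1 repr_mx1 mul1mx /=.
  move=> /setIdP[gG /eqP gv] /setIdP[hG /eqP hv].
  by rewrite inE groupM // repr_mxM // -mulmxA hv gv /=.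
have sKG : group gK \subset G by apply/subsetP => g /setIdP[].
have sPK : P \subset group gK.
  apply/subsetP => g gP; have gG := subsetP sPG g gP; rewrite inE gG -chi1 //=.
  have chiX m : chi (g ^+ m)%g = chi g ^+ m.
    elim: m => [|m IH].
      by apply/eqP; rewrite expg0 expr0 chi1 ?group1 // repr_mx1 mul1mx.
    by rewrite expgS exprS chiM ?groupX // IH.
  have pnat_P : [pchar k].-nat #|P|.
    exact: pi_pnat (pHall_pgroup sylP) pk.
  (* (chi g - 1) ^ |P| = chi g ^ |P| - 1 = 0 by the Frobenius morphism *)
  have := exprDn_pchar (chi g) (- 1) pnat_P.
  rewrite exprNn_pchar // expr1n -chiX expg_cardG //.
  have -> : chi 1%g = 1 by apply/eqP; rewrite chi1 // repr_mx1 mul1mx.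
  by rewrite subrr => /eqP; rewrite expf_eq0 subr_eq0 => /andP[].
have [eqKP|neqKP] := eqVneq (group gK : {set gT}) P.
  case/negP: nPcyc; apply/andP.
  have memP g : g \in G -> (g \in P) = (chi g == 1).
    by move=> gG; rewrite -eqKP inE gG chi1.
  have nPG : G \subset 'N(P).
    apply/subsetP => g gG; rewrite inE; apply/subsetP => _ /imsetP[h hP ->].
    have hG := subsetP sPG h hP.
    rewrite memP ?groupJ // conjgE !chiM ?groupM ?groupV // mulrCA -chiM ?groupV //.
    by rewrite mulVg (eqP (_ : chi h == 1)) -?memP // mul1r -memP.
  split; first exact/andP.
  pose f (C : coset_of P) := chi (repr C).
  have fE g : g \in G -> f (coset P g) = chi g.
    move=> gG; rewrite /f; have := mem_repr_coset (coset P g).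
    rewrite val_coset ?(subsetP nPG) // => /rcosetP[h hP ->].
    have hG := subsetP sPG h hP.
    by rewrite chiM // (eqP (_ : chi h == 1)) -?memP // mul1r.
  apply: (@field_mul_group_cyclic _ _ k f) => [C D|C] /morphimP[g nPg gG ->].
    move=> /morphimP[h nPh hG ->].
    by rewrite -morphM // !fE ?groupM // chiM.
  rewrite fE //; split=> [/eqP|gP]; first by rewrite -memP // => /coset_id.
  by apply/eqP; rewrite -memP //; apply: coset_idr.
have ltPK : (#|P| < #|group gK|)%N.
  by rewrite proper_card // properEneq eq_sym neqKP.
have nzK : #|group gK : P|%:R != 0 :> k.
  have sylPK := pHall_subl sPK sKG sylP.
  have [_ _ pidx] := and3P sylPK.
  by rewrite -(dvdn_pcharf pk) -p'natE ?(pcharf_prime pk).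
have sepK : separated rG (group gK) #|P| v.
  apply: (separated_transfer (rG := subg_repr rG sKG) sPK nzK).
    by move=> g /setIdP[_ /eqP].
  exact: separated_order.
apply: separated_leq (separated_index sKG sepK).
rewrite -ltnS (ltn_predK (cardG_gt0 G)) -(Lagrange sKG) mulnC.
by rewrite ltn_pmul2r ?indexg_gt0.
Qed.

End Eigenvector.

End Module.

Lemma sigma_leq d :
    (forall n (rG : mx_representation k G n) (v : 'cV_n),
       v != 0 -> separated rG G d v) ->
  (sigma k G <= d)%N.
Proof.
move=> sepd; rewrite /sigma; case: ex_minnP => m _; apply; apply/asboolP => n rG.
rewrite /sigma_module; case: ex_minnP => e _; apply; apply/asboolP.
split=> [f []//|v vN].
have v0 : v != 0 by apply/eqP => v0; apply: vN => f [_ f0]; rewrite v0 evalV0.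
have [f [fG fd f0 fv]] := sepd n rG v v0.
by exists f => //; split; rewrite -?evalV0.
Qed.

(** Vectors outside the nullcone are separated by definition of sigma, and the
    nullcone of a finite group is trivial by [separated_order]. *)
Lemma sigma_separated n (rG : mx_representation k G n) (v : 'cV_n) :
  v != 0 -> separated rG G (sigma k G) v.
Proof.
move=> v0; rewrite /sigma; case: ex_minnP => m /asboolP/(_ n rG) le_m _.
apply: separated_leq le_m _.
rewrite /sigma_module; case: ex_minnP => d /asboolP[_ sepd] _.
have [f [[fG fd] f0] fv] : exists2 f, plus (invariant_le rG d) f & evalV f v != 0.
  apply: sepd => vN; have [f [fG _ f0 fv]] := separated_order rG (subxx G) v0.
  by case/eqP: fv; apply: vN; split; rewrite -?evalV0.
by exists f; split; rewrite ?evalV0.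
Qed.

Lemma sigma_leq_order : (sigma k G <= #|G|)%N.
Proof. by apply: sigma_leq => n rG v; apply: separated_order. Qed.

(** Otherwise every nonzero vector, whether or not it is an eigenvector of G, is
    (|G| - 1)-separated. *)
Lemma sigma_eq_order p (P : {group gT}) :
    p \in [pchar k] -> p.-Sylow(G) P -> sigma k G = #|G| ->
  P <| G /\ cyclic (G / P)%g.
Proof.
move=> pk sylP oG; apply/andP; apply: contraTT isT => nPcyc.
suffices: (sigma k G <= #|G|.-1)%N.
  by rewrite oG -ltnS (ltn_predK (cardG_gt0 G)) ltnn.
apply: sigma_leq => n rG v v0.
have [Gv|] := boolP [forall g in G, ((rG g *m v)^T <= v^T)%MS].
  apply: separated_eigenvector pk sylP nPcyc => // g gG.
  by have/forall_inP := Gv; apply.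
rewrite negb_forall_in => /exists_inP[g gG gv].
exact: separated_not_eigenvector gv.
Qed.

End Sigma.

(** * Roots of unity and characters of cyclic quotients *)

Section RootsOfUnity.
Local Open Scope ring_scope.

Lemma closed_prim_root_ex (k : closedFieldType) m :
  m%:R != 0 :> k -> exists z : k, m.-primitive_root z.
Proof.
move=> m0; have m_gt0 : (0 < m)%N by case: m m0 => //; rewrite eqxx.
have [rs] := closed_field_poly_normal ('X^m - 1 : {poly k}).
have /monicP -> : ('X^m - 1 : {poly k}) \is monic by rewrite monicXnsubC.
rewrite scale1r => defp.
have us : uniq rs by rewrite -separable_prod_XsubC -defp separable_Xn_sub_1.
have srs : size rs = m.
  by apply/eqP; rewrite -eqSS -(size_prod_XsubC rs id) -defp size_XnsubC.
have /hasP[z _ zP] : has m.-primitive_root rs.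
  apply: has_prim_root; rewrite ?srs //; apply/allP => z zrs.
  have : root (\prod_(x <- rs) ('X - x%:P)) z by rewrite root_prod_XsubC.
  by rewrite -defp.
by exists z.
Qed.

(** The extension by 0 outside N is also multiplicative for right translations by
    elements of N, which is what makes it an eigenvector of N in the module of
    functions on the whole group. *)
Lemma cyclic_quotient_char (k : closedFieldType) (gT : finGroupType)
    (N P : {group gT}) :
    P <| N -> cyclic (N / P)%g -> #|(N / P)%g|%:R != 0 :> k ->
  exists chi : gT -> k,
    [/\ forall h, {in N, forall g, chi (h * g)%g = chi h * chi g},
        chi 1%g = 1, {in P, forall g, chi g = 1}
      & exists2 g, g \in N & #|(N / P)%g|.-primitive_root (chi g)].
Proof.
move=> /andP[sPN nPN] /cyclicP[c defc] nz; have [z zP] := closed_prim_root_ex nz.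
have /choice[e eP] : forall g, exists i, g \in N -> coset P g = (c ^+ i)%g.
  move=> g; have [gN|] := boolP (g \in N); last by exists 0%N.
  have /cycleP[i ->] : coset P g \in <[c]>%g by rewrite -defc mem_quotient.
  by exists i.
have oc : #[c]%g = #|(N / P)%g| by rewrite defc orderE.
have zE i j : (c ^+ i = c ^+ j)%g -> z ^+ i = z ^+ j.
  by move=> /eqP; rewrite eq_expg_mod_order oc -(eq_prim_root_expr zP) => /eqP.
exists (fun g => if g \in N then z ^+ e g else 0); split=> [h g gN|||].
- rewrite gN groupMr //; case: ifP => hN; last by rewrite mul0r.
  rewrite -exprD; apply: zE; rewrite expgD -!eP ?groupM // morphM //.
    exact: subsetP nPN _ hN.
  exact: subsetP nPN _ gN.
- by rewrite group1 -(expr0 z); apply: zE; rewrite -eP // coset_id.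
- move=> g gP; rewrite (subsetP sPN) // -(expr0 z); apply: zE.
  by rewrite -eP ?(subsetP sPN) // coset_id.
have /morphimP[g nPg gN defg] : c \in (N / P)%g by rewrite defc cycle_id.
exists g; rewrite ?gN // (_ : z ^+ e g = z) // -[RHS]expr1; apply: zE.
by rewrite -eP // -defg.
Qed.

End RootsOfUnity.

(** * The lower bound from functions on the group *)

Section Regular.
Local Open Scope ring_scope.

(** Every orbit has p-power length; as no orbit is a singleton, the sum over each
    orbit is a multiple of p. *)
Lemma pgroup_sum_eq0 (R : nzRingType) (p : nat) (aT : finGroupType)
    (T : finType) (to : {action aT &-> T}) (P : {group aT}) (X : {set T})
    (F : T -> R) :
    p \in [pchar R] -> p.-group P -> [acts P, on X | to] ->
    {in X & P, forall x g, F (to x g) = F x} ->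
    'Fix_(X | to)(P) = set0 ->
  \sum_(x in X) F x = 0.
Proof.
move=> pR pP actsP Finv noFix; rewrite (set_partition_big _ (orbit_partition actsP)).
apply: big1 => _ /imsetP[x xX ->].
rewrite (eq_bigr (fun=> F x)) => [|_ /orbitP[g gP <-]]; last exact: Finv.
rewrite sumr_const card_orbit -mulr_natr.
suffices /dvdnP[j ->] : (p %| #|P : 'C_P[x | to]|)%N.
  by rewrite natrM (pcharf0 pR) !mulr0.
have p_pr := pcharf_prime pR.
have : p.-nat #|P : 'C_P[x | to]| by apply: pnat_dvd pP; apply: dvdn_indexg.
case/p_natP=> [[|e] idx]; last by rewrite idx dvdn_exp.
move/eqP: idx; rewrite expn0 indexg_eq1 subsetI subxx => sPCx.
have : x \in 'Fix_(X | to)(P).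
  by rewrite inE xX; apply/afixP => g gP; apply/astab1P/(subsetP sPCx).
by rewrite noFix inE.
Qed.

Lemma dvdn_sum_translates (gT : finGroupType) (P : {group gT}) (F : gT -> nat) :
  (forall h, {in P, forall g, F (h * g)%g = F h}) -> (#|P| %| \sum_h F h)%N.
Proof.
move=> FP; rewrite (partition_big (fun h => h *: P)%g predT) //=.
apply: dvdn_sum => C _; have [[h <-]|noC] := pselect (exists h, (h *: P)%g = C).
  rewrite (eq_bigl (mem (h *: P)%g)) => [|g]; last first.
    exact/eqP/lcoset_eqP.
  rewrite (eq_bigr (fun=> F h)) => [|_ /lcosetP[g gP ->]]; last exact: FP.
  by rewrite sum_nat_const card_lcoset dvdn_mulr.
by rewrite big1 // => h /eqP hC; case: noC; exists h.
Qed.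

Variables (k : closedFieldType) (gT : finGroupType).
Local Notation n := #|gT|.

(** Right translation by g on the whole type gT, enumerated; using all of gT
    rather than G makes it a total action without membership conditions. *)
Definition shift_fun (g : gT) (i : 'I_n) : 'I_n := enum_rank (enum_val i * g)%g.

Lemma shift_fun_inj g : injective (shift_fun g).
Proof. by move=> i j /enum_rank_inj/mulIg/enum_val_inj. Qed.

Definition shift g : 'S_n := perm (@shift_fun_inj g).

Lemma shiftE g i : shift g i = enum_rank (enum_val i * g)%g.
Proof. by rewrite permE. Qed.

Lemma shiftM g h : shift (g * h)%g = (shift g * shift h)%g.
Proof. by apply/permP => i; rewrite permM !shiftE enum_rankK mulgA. Qed.

Lemma shift1 : shift 1%g = 1%g.
Proof. by apply/permP => i; rewrite perm1 shiftE mulg1 enum_valK. Qed.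

Lemma shiftV g : shift g^-1%g = ((shift g)^-1)%g.
Proof. by apply/eqP; rewrite eq_sym eq_invg_mul -shiftM mulgV shift1. Qed.

Lemma translation_mx_repr (G : {group gT}) :
  mx_repr G (fun g => perm_mx (shift g) : 'M[k]_n).
Proof.
by split=> [|g h _ _]; rewrite ?shift1 ?perm_mx1 // shiftM perm_mxM.
Qed.

Definition translation_repr (G : {group gT}) := MxRepresentation (translation_mx_repr G).

Variables (G : {group gT}).
Local Notation rG := (translation_repr G).

Lemma actp_translation g f : actp rG g f = msym (shift g^-1%g) f.
Proof.
rewrite -[RHS]comp_mpoly_id msym_mPo /actp; congr (_ \mPo _).
apply: eq_from_tnth => i; rewrite !tnth_mktuple.
rewrite (bigD1 (shift g^-1%g i)) //= /perm_mx !mxE eqxx scale1r big1 ?addr0 // => j.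
by rewrite !mxE eq_sym => /negbTE ->; rewrite scale0r.
Qed.

Section Evaluation.
Variables (N P : {group gT}) (p : nat) (chi : gT -> k) (f : {mpoly k[n]}) (D : nat).
Hypotheses (pk : p \in [pchar k]) (pP : p.-group P) (sPN : P \subset N).
Hypothesis chiM : forall h, {in N, forall g, chi (h * g)%g = chi h * chi g}.
Hypothesis chiP : {in P, forall g, chi g = 1}.
Hypothesis fN : fixes rG N f.

Definition char_vector : 'cV[k]_n := \col_i chi (enum_val i).
Local Notation v := char_vector.

Definition term (m : 'X_{1..n}) : k := f@_m * \prod_i v i 0 ^+ m i.

Definition mpermg (m : 'X_{1..n}) (g : gT) : 'X_{1..n} :=
  [multinom m (shift g^-1%g i) | i < n].

Lemma mdeg_mpermg m g : mdeg (mpermg m g) = mdeg m.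
Proof. exact: mdeg_mperm. Qed.

(** Invariance of f equates the coefficients; the monomials differ by the factor
    coming from g acting on its eigenvector v. *)
Lemma term_mpermg m g : g \in N -> term (mpermg m g) = chi g ^+ mdeg m * term m.
Proof.
move=> gN; rewrite /term mulrCA; congr (_ * _).
  by rewrite -{2}(fN gN) actp_translation mcoeff_sym.
rewrite (reindex_inj (@perm_inj _ (shift g))) mdegE -prodrXr -big_split /=.
apply: eq_bigr => i _; rewrite mnmE shiftV permK -exprMn; congr (_ ^+ _).
by rewrite !mxE shiftE enum_rankK chiM // mulrC.
Qed.

(** Bounding the degree makes the exponents a finite type, where orbits can be
    counted. *)
Definition bmpermg (m : 'X_{1..n < D}) (g : gT) : 'X_{1..n < D} :=
  @BMultinom n D (mpermg m g) (eq_ind_r (fun d => d < D)%N (bmdeg m) (mdeg_mpermg m g)).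

Lemma bmpermg1 : bmpermg^~ 1%g =1 id.
Proof.
by move=> m; apply: val_inj; apply/mnmP => i; rewrite mnmE invg1 shift1 perm1.
Qed.

Lemma bmpermgM m : act_morph bmpermg m.
Proof.
move=> g h; apply: val_inj; apply/mnmP => i.
by rewrite !mnmE invMg shiftM permM.
Qed.

Definition bmpermg_action := TotalAction bmpermg1 bmpermgM.

Definition homog_value d : k := \sum_(m : 'X_{1..n < D} | mdeg m == d) term m.

Lemma homog_value_char d g : g \in N -> homog_value d = chi g ^+ d * homog_value d.
Proof.
move=> gN; rewrite {1}/homog_value.
rewrite (reindex_inj (@act_inj _ _ _ bmpermg_action g)) /=.
rewrite mulr_sumr; apply: eq_big => [m|m]; rewrite mdeg_mpermg //.
by move/eqP <-; rewrite term_mpermg.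
Qed.

(** Otherwise P fixes no monomial of degree d: the exponent of a fixed one is
    constant on the cosets of P, so |P| divides its degree. *)
Lemma homog_value_pgroup d : homog_value d != 0 -> (#|P| %| d)%N.
Proof.
apply: contraNT => ndvd; rewrite /homog_value.
rewrite (eq_bigl (mem [set m : 'X_{1..n < D} | mdeg m == d])) => [|m]; last first.
  by rewrite [RHS]inE.
apply/eqP; apply: (pgroup_sum_eq0 (to := bmpermg_action) pk pP).
- by apply/actsP => g gP m; rewrite !inE /= mdeg_mpermg.
- move=> m g _ gP; rewrite term_mpermg ?(subsetP sPN) //.
  by rewrite chiP // expr1n mul1r.
apply/setP => m; rewrite in_setI in_set0; apply: contraNF ndvd => /andP[].
rewrite inE => /eqP <- /afixP fixm.
rewrite mdegE (reindex (@enum_rank gT)) /=; last exact/onW_bij/enum_rank_bij.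
apply: dvdn_sum_translates => h g gP.
have /(congr1 (fun m' : 'X_{1..n < D} => m' (enum_rank h))) := fixm _ (groupVr gP).
by rewrite /= mnmE invgK shiftE enum_rankK.
Qed.

Lemma evalV_char_vector : (msize f <= D)%N ->
  evalV f v = \sum_(d < D) homog_value d.
Proof.
move=> fD; rewrite {1}(mpolywE fD) evalV_sum.
rewrite (partition_big (fun m : 'X_{1..n < D} => Ordinal (bmdeg m)) predT) //=.
apply: eq_bigr => d _; apply: eq_bigr => m _.
by rewrite /evalV mevalZ mevalX.
Qed.

Lemma homog_value0 : evalV f 0 = 0 -> homog_value 0 = 0.
Proof.
rewrite evalV0 => f0; apply: big1 => m.
by rewrite mdeg_eq0 => /eqP m0; rewrite /term m0 f0 mul0r.
Qed.

End Evaluation.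

(** By [homog_value_char] and [homog_value_pgroup] an invariant can be nonzero at
    the vector of chi only in degrees divisible by both [N : P] and |P|, which
    are coprime. *)
Theorem sigma_geq_cyclic_quotient (N P : {group gT}) (p : nat) :
    p \in [pchar k] -> p.-Sylow(N) P -> P <| N -> N \subset G ->
    cyclic (N / P)%g ->
  (#|N| <= sigma k G)%N.
Proof.
move=> pk sylP nsPN sNG cycNP; have p_pr := pcharf_prime pk.
have [sPN nPN] := andP nsPN; have [_ pP p'idx] := and3P sylP.
rewrite leqNgt; apply/negP => lt_sig.
have oNP : #|(N / P)%g| = #|N : P| by rewrite card_quotient.
have coNP : coprime #|P| #|N : P| by apply: pnat_coprime p'idx.
have nz : #|(N / P)%g|%:R != 0 :> k by rewrite oNP -(dvdn_pcharf pk) -p'natE.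
have [chi [chiM chi1 chiP [c cN prim_c]]] := cyclic_quotient_char nsPN cycNP nz.
have v0 : char_vector chi != 0.
  apply/eqP => /matrixP/(_ (enum_rank 1%g) 0); rewrite !mxE enum_rankK chi1.
  by move/eqP; rewrite oner_eq0.
have [f [fG fsig f0]] := sigma_separated rG v0.
have fN : fixes rG N f by move=> g gN; rewrite fG ?(subsetP sNG).
have fD : (msize f <= #|N|)%N by apply: leq_trans fsig _.
rewrite (evalV_char_vector _ fD) => /eqP; case; apply: big1 => -[d ltdN] _ /=.
have [->|d_gt0] := posnP d; first exact: homog_value0.
apply/eqP; apply: contraTT isT => nzd.
have dvdP := homog_value_pgroup pk pP sPN chiM chiP fN nzd.
have : chi c ^+ d = 1.
  by apply: (mulIf nzd); rewrite mul1r -(homog_value_char _ chiM fN).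
move=> /eqP; rewrite -(prim_order_dvd prim_c) oNP => dvdI.
have : (#|N| %| d)%N by rewrite -(Lagrange sPN) Gauss_dvd // dvdP.
by move/(dvdn_leq d_gt0); rewrite leqNgt ltdN.
Qed.

End Regular.

(** * Eigencomponents and noncyclic q-groups *)

Lemma sum_expr_unity (R : idomainType) (a : R) m :
  (a ^+ m = 1 -> a != 1 -> \sum_(i < m) a ^+ i = 0)%R.
Proof.
move=> am a1; apply/eqP; have /eqP := subrX1 a m.
by rewrite am subrr eq_sym mulf_eq0 subr_eq0 (negbTE a1).
Qed.

Lemma big_cyclic_shift (T : Type) (idx : T) (op : Monoid.com_law idx)
    (t : nat -> T) m :
  t m = t 0 -> \big[op/idx]_(i < m) t i.+1 = \big[op/idx]_(i < m) t i.
Proof.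
case: m => [|m] tm; first by rewrite !big_ord0.
by rewrite big_ord_recr /= tm [RHS]big_ord_recl Monoid.mulmC.
Qed.

Section Eigencomponents.
Local Open Scope ring_scope.
Variables (k : closedFieldType) (gT : finGroupType) (G : {group gT}) (n : nat).
Variable rG : mx_representation k G n.
Implicit Types (g h : gT) (f : {mpoly k[n]}) (v : 'cV[k]_n).

Lemma actpD g : {morph actp rG g : f f' / f + f'}.
Proof. by move=> f f'; rewrite /actp raddfD. Qed.

Lemma actp0 g : actp rG g 0 = 0. Proof. by rewrite /actp raddf0. Qed.

Lemma actpX_fix g f j : g \in G -> actp rG g f = f -> actp rG (g ^+ j)%g f = f.
Proof.
move=> gG gf; elim: j => [|j IH]; first by rewrite expg0 actp1.
by rewrite expgS (actpM _ _ gG (groupX j gG)) IH.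
Qed.

Lemma actpX_eigen g f w j :
  g \in G -> actp rG g f = w *: f -> actp rG (g ^+ j)%g f = w ^+ j *: f.
Proof.
move=> gG gf; elim: j => [|j IH]; first by rewrite expg0 actp1 scale1r.
by rewrite expgS (actpM _ _ gG (groupX j gG)) IH actpZ gf scalerA -exprSr.
Qed.

(** As a ^+ m fixes f and m is invertible in k, the element a acts diagonalisably
    on the span of its translates of f. So m * f is a sum of eigenvectors of a,
    one of which does not vanish at v. The predicate W stands
    for whatever the components must inherit from f: degree bounds, invariance,
    or being an eigenvector of other elements. *)
Lemma eigencomponent_ex (W : {mpoly k[n]} -> Prop) a m v f :
    a \in G -> m%:R != 0 :> k ->
    W 0 -> (forall w f1 f2, W f1 -> W f2 -> W (w *: f1 + f2)) ->
    (forall f1, W f1 -> W (actp rG a f1)) ->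
    W f -> actp rG (a ^+ m)%g f = f -> evalV f v != 0 ->
  exists f' w, [/\ W f', w ^+ m = 1, actp rG a f' = w *: f' & evalV f' v != 0].
Proof.
move=> aG; case: m => [|m] m0 W0 WD Wa Wf afm fv; first by rewrite mulr0n eqxx in m0.
have [z zP] := closed_prim_root_ex m0.
pose comp u : {mpoly k[n]} := \sum_(i < m.+1) u ^+ i *: actp rG (a ^+ i)%g f.
have Wcomp u : W (comp u).
  rewrite /comp; elim/big_rec: _ => [//|i f' _ Wf'].
  apply: WD => //; elim: (i : nat) => [|j IH]; first by rewrite actp1.
  by rewrite expgS (actpM _ _ aG (groupX j aG)); apply: Wa.
have acomp u : u ^+ m.+1 = 1 -> actp rG a (comp u) = u^-1 *: comp u.
  move=> um; have u0 : u != 0.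
    by apply: contra_eq_neq um => ->; rewrite expr0n eq_sym oner_eq0.
  have shiftu : u *: actp rG a (comp u) = comp u.
    (* acting by a and multiplying by u shifts the summation index *)
    pose t i : {mpoly k[n]} := u ^+ i *: actp rG (a ^+ i)%g f.
    have tS i : u *: actp rG a (t i) = t i.+1.
      by rewrite /t actpZ -(actpM _ _ aG (groupX i aG)) -expgS scalerA -exprS.
    rewrite -[RHS](@big_cyclic_shift _ _ _ t); first by rewrite actp_sum scaler_sumr;
      apply: eq_bigr => i _; apply: tS.
    by rewrite /t um afm expr0 expg0 actp1.
  by rewrite -[in RHS]shiftu scalerA mulVf // scale1r.
have sum_comp : \sum_(j < m.+1) comp (z ^+ j) = m.+1%:R *: f.
  rewrite exchange_big /=.
  rewrite (bigD1 ord0) //= [X in _ + X]big1 ?addr0 => [|i i0].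
    under eq_bigr => j _ do rewrite expr0 actp1 scale1r.
    by rewrite sumr_const card_ord scaler_nat.
  rewrite -scaler_suml.
  under eq_bigr => j _ do rewrite exprAC.
  rewrite sum_expr_unity ?scale0r //; first by rewrite exprAC (prim_expr_order zP) expr1n.
  rewrite -(prim_order_dvd zP); apply/negP => /dvdn_leq.
  by rewrite lt0n => /(_ i0); rewrite leqNgt ltn_ord.
have [j cj] : exists j : 'I_m.+1, evalV (comp (z ^+ j)) v != 0.
  apply/existsP; apply: contraNT fv; rewrite negb_exists => /forallP c0.
  rewrite -(mulrI_eq0 _ (mulfI m0)) -evalVZ -sum_comp evalV_sum big1 // => j _.
  by apply/eqP; have := c0 j; rewrite negbK.
have zjm : (z ^+ j) ^+ m.+1 = 1 by rewrite exprAC (prim_expr_order zP) expr1n.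
exists (comp (z ^+ j)), (z ^+ j)^-1; split=> //; last exact: acomp.
by rewrite exprVn zjm invr1.
Qed.

(** Refining a Phi(Q)-invariant into eigencomponents for one element of Q after
    another gives a common eigenvector of Q, since Q / Phi(Q) is abelian. Its
    q-th power is Q-invariant, as Q / Phi(Q) has exponent q, and has degree at
    most q * |Phi(Q)|, which is at most |Q| / q because |Q / Phi(Q)| >= q ^ 2. *)
Lemma separated_noncyclic (Q : {group gT}) (q : nat) v :
    Q \subset G -> q.-group Q -> q%:R != 0 :> k -> ~~ cyclic Q -> v != 0 ->
  separated rG Q (#|Q| %/ q) v.
Proof.
move=> sQG qQ q0 ncycQ v0; pose N := 'Phi(Q)%G.
have sNQ : N \subset Q := Phi_sub Q.
have nNQ : Q \subset 'N(N) := gFnorm _ _.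
have ntQ : Q :!=: 1%g by apply: contraNneq ncycQ => ->; apply: cyclic1.
have [q_pr _ _] := pgroup_pdiv qQ ntQ.
have [abQN expQN] := abelemP q_pr (Phi_quotient_abelem qQ).
have sGN b : b \in N -> b \in G by move/(subsetP sNQ)/(subsetP sQG).
have QG b : b \in Q -> b \in G := subsetP sQG b.
(* the conditions on a common eigenvector of the elements of s *)
pose W (s : seq gT) (w : gT -> k) f := [/\ fixes rG N f, (msize f <= #|N|.+1)%N,
  evalV f 0 = 0 & {in s, forall b, actp rG b f = w b *: f}].
have Wa (s : seq gT) w a f :
    {subset s <= Q} -> a \in Q -> W s w f -> W s w (actp rG a f).
  move=> sQ aQ [fN fd f0 fs]; have aG := QG a aQ; split.
  - move=> b bN; have bG := sGN b bN.
    have baN : (b ^ a)%g \in N by rewrite memJ_norm ?(subsetP nNQ).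
    by rewrite -(actpM _ _ bG aG) conjgC (actpM _ _ aG (sGN _ baN)) fN.
  - exact: leq_trans (msize_actp _ _ _) fd.
  - by rewrite evalV_actp0.
  - move=> b bs; have bQ := sQ b bs; have bG := QG b bQ.
    have baN : [~ b, a]%g \in N.
      apply: subsetP (mem_commg bQ aQ).
      by rewrite -quotient_cents2.
    rewrite -(actpM _ _ bG aG) commgC (actpM _ _ (groupM aG bG) (sGN _ baN)) fN //.
    by rewrite (actpM _ _ aG bG) fs // actpZ.
have WD (s : seq gT) w e f1 f2 : W s w f1 -> W s w f2 -> W s w (e *: f1 + f2).
  move=> [f1N f1d f10 f1s] [f2N f2d f20 f2s]; split.
  - by move=> b bN; rewrite actpD actpZ f1N // f2N.
  - rewrite (leq_trans (msizeD_le _ _)) // geq_max f2d andbT.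
    exact: leq_trans (msizeZ_le _ _) f1d.
  - by rewrite evalVD evalVZ f10 f20 mulr0 addr0.
  - by move=> b bs; rewrite actpD actpZ f1s // f2s // scalerDr !scalerA mulrC.
have W0 (s : seq gT) w : W s w 0.
  split=> [b _|||b _]; rewrite ?actp0 ?msize0 ?scaler0 //.
  by rewrite /evalV meval0.
have [w [f [Wf wq fv]]] : exists w f,
    [/\ W (enum Q) w f, {in enum Q, forall b, w b ^+ q = 1} & evalV f v != 0].
  have : {subset enum Q <= Q} by move=> b; rewrite mem_enum.
  elim: (enum Q) => [_|a s IHs sQ].
    have [f [fN fd f0 fv]] := separated_order rG (subset_trans sNQ sQG) v0.
    by exists (fun=> 0), f.
  have aQ : a \in Q by rewrite sQ ?mem_head.
  have s'Q : {subset s <= Q} by move=> b bs; rewrite sQ ?inE ?bs ?orbT.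
  have [w [f [Wf wq fv]]] := IHs s'Q.
  have aqN : (a ^+ q)%g \in N.
    rewrite -[N : {set _}]/('Phi(Q)) coset_idr ?groupX ?(subsetP nNQ) //.
    by rewrite morphX ?(subsetP nNQ) //= expQN // mem_quotient.
  have aqf : actp rG (a ^+ q)%g f = f by case: Wf => fN _ _ _; apply: fN.
  have [f' [u [Wf' uq af' f'v]]] := eigencomponent_ex (QG a aQ) q0 (W0 s w) (@WD s w)
    (fun f1 => @Wa s w a f1 s'Q aQ) Wf aqf fv.
  exists (fun b => if b == a then u else w b), f'; split=> //.
    case: Wf' => f'N f'd f'0 f's; split=> // b; rewrite inE.
    by case: eqP => [->|_ /= /f's].
  by move=> b; rewrite inE; case: eqP => [//|_ /= /wq].
case: Wf => [fN fd f0 fs]; exists (f ^+ q); split.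
- move=> b bQ; rewrite actpX fs ?mem_enum // exprZn wq ?mem_enum // scale1r //.
- apply: leq_trans (msizeX_le q fd) _; rewrite ltnS leq_divRL ?prime_gt0 //.
  rewrite mulnAC mulnC -(Lagrange sNQ) leq_pmul2l // -card_quotient //.
  have ncycQN : ~~ cyclic (Q / N) by apply: contra ncycQ; apply: Phi_quotient_cyclic.
  have /p_natP[[|[|e]] oQN] : q.-nat #|(Q / N)%g| := quotient_pgroup _ qQ.
  + by case/negP: ncycQN; rewrite (card1_trivg oQN) cyclic1.
  + by case/negP: ncycQN; rewrite prime_cyclic // oQN expn1.
  + by rewrite oQN (leq_pexp2l (prime_gt0 q_pr) (isT : 2 <= e.+2)%N).
- by rewrite evalVX f0 expr0n; case: (q) q_pr.
- by rewrite evalVX expf_neq0.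
Qed.
End Eigencomponents.

(** * Short zero sums modulo a prime *)

Section ZeroSums.
Local Open Scope ring_scope.

Lemma prime_prim_root (R : nzRingType) (q : nat) (w : R) :
  prime q -> w ^+ q = 1 -> w != 1 -> q.-primitive_root w.
Proof.
move=> q_pr wq w1; have [m' wm' dvdm] := prim_order_exists (prime_gt0 q_pr) wq.
have /primeP[_ /(_ m' dvdm) /orP[/eqP m1|/eqP <- //]] := q_pr.
by move: (prim_expr_order wm'); rewrite m1 expr1 => w1'; rewrite w1' eqxx in w1.
Qed.

(** Start with every w i once, for a total W, and complete with a single w i taken
    u i := - W / w i further times. If W != 0 the residues u i are distinct and nonzero,
    so not all #|S| of them can lie among the #|S| - 1 numbers from q - #|S| + 1
    to q - 1: for some i the length #|S| + u i is at most q. *)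
Lemma short_zero_sum (q : nat) (I : finType) (S : {set I}) (w : I -> 'F_q) :
    prime q -> S != set0 -> {in S &, injective w} -> {in S, forall i, w i != 0} ->
  exists m : I -> nat, [/\ {in S, forall i, 0 < m i}%N, (\sum_(i in S) m i <= q)%N
    & \sum_(i in S) w i *+ m i = 0].
Proof.
move=> q_pr S0 wI w0; pose W := \sum_(i in S) w i; pose u i := - W / w i.
have oFq : #|'F_q| = q by rewrite card_Fp.
have [i iS ui] : exists2 i, i \in S & (u i + #|S| <= q)%N.
  have sSq : (#|S| <= q)%N by rewrite -(card_in_imset wI) -[leqRHS]oFq max_card.
  have [W0|W0] := eqVneq W 0.
    by have /set0Pn[i iS] := S0; exists i => //; rewrite /u W0 oppr0 mul0r.
  apply/exists_inP; apply: contraT; rewrite negb_exists_in => /forall_inP big_u.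
  have uI : {in S &, injective (fun i => u i : nat)}.
    move=> i j iS jS /val_inj/(mulfI (_ : - W != 0)); rewrite oppr_eq0 => /(_ W0).
    by move/invr_inj; apply: wI.
  have : {subset [seq (u i : nat) | i <- enum S] <= iota (q - #|S|).+1 #|S|.-1}.
    move=> _ /mapP[i iS ->]; rewrite mem_enum in iS.
    have := big_u i iS; rewrite -ltnNge mem_iota.
    have cS : (0 < #|S|)%N by rewrite card_gt0.
    have ltuq : (u i < q)%N by rewrite -[ltnRHS](Fp_cast q_pr) ltn_ord.
    lia.
  move/uniq_leq_size; rewrite map_inj_in_uniq ?enum_uniq; last first.
    by move=> i j; rewrite !mem_enum; apply: uI.
  rewrite size_map size_iota -cardE => /(_ isT).
  by have : (0 < #|S|)%N by [rewrite card_gt0]; case: #|S| => // s _; rewrite ltnn.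
exists (fun j => (1 + (j == i) * u i)%N); split=> //.
  rewrite big_split /= sum1_card (bigD1 i) //= eqxx mul1n big1 => [|j /andP[_ /negbTE ->]];
    by rewrite ?addn0 // addnC.
have -> : \sum_(j in S) w j *+ (1 + (j == i) * u i) = W + w i *+ u i.
  under eq_bigr => j _ do rewrite mulrnDr mulr1n.
  rewrite big_split -/W; congr (_ + _).
  rewrite (bigD1 i) // big1 => [|j /andP[_ /negbTE ->] //].
  by apply: etrans (addr0 _) _; rewrite eqxx mul1n.
by rewrite -mulr_natr natr_Zp /u mulrC divfK ?w0 // subrr.
Qed.

End ZeroSums.

(** * An element of p-power order acting on a group of prime order *)

Lemma fixes_joing (k : closedFieldType) (gT : finGroupType) (G : {group gT}) n
    (rG : mx_representation k G n) (A B : {set gT}) (f : {mpoly k[n]}) :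
    A \subset G -> B \subset G -> fixes rG A f -> fixes rG B f ->
  fixes rG (A <*> B) f.
Proof.
move=> sAG sBG fA fB; pose S := [set g in G | `[< actp rG g f = f >]].
have gS : group_set S.
  apply/group_setP; split=> [|g h]; first by rewrite inE group1; apply/asboolP/actp1.
  move=> /setIdP[gG /asboolP gf] /setIdP[hG /asboolP hf].
  by rewrite inE groupM //; apply/asboolP; rewrite (actpM _ _ gG hG) hf.
have sS : A <*> B \subset group gS.
  rewrite join_subG; apply/andP; split; apply/subsetP => g gAB; rewrite inE.
    by rewrite (subsetP sAG) //; apply/asboolP/fA.
  by rewrite (subsetP sBG) //; apply/asboolP/fB.
by move=> g /(subsetP sS)/setIdP[_ /asboolP].
Qed.

Lemma fixes_cycle (k : closedFieldType) (gT : finGroupType) (G : {group gT}) n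
    (rG : mx_representation k G n) (g : gT) (f : {mpoly k[n]}) :
  g \in G -> actp rG g f = f -> fixes rG <[g]> f.
Proof. by move=> gG gf _ /cycleP[j ->]; apply: actpX_fix. Qed.

(** The multiples of j cover all residues modulo p. *)
Lemma periodic_shift_closed (p j : nat) (b : pred nat) :
    prime p -> ~~ (p %| j)%N -> (forall i, b (i + p)%N = b i) -> b 0%N ->
    (forall i, (i < p)%N -> b i -> b (i + j)%N) ->
  forall i, b i.
Proof.
move=> p_pr ndvd bp b0 bj i.
have bpM s r : b (r + s * p)%N = b r.
  by elim: s => [|s IH]; rewrite ?mul0n ?addn0 // mulSnr addnA bp.
have bmod r : b (r %% p)%N = b r by rewrite [in RHS](divn_eq r p) addnC bpM.
have bjM s : b (s * j)%N.
  elim: s => [//|s]; rewrite mulSnr -bmod -[b (_ + j)%N]bmod -modnDml [in X in _ -> X]bmod.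
  by apply: bj; rewrite ltn_mod prime_gt0.
have j_gt0 : (0 < j)%N by case: j ndvd {bj bjM} => //; rewrite dvdn0.
have cjp : coprime j p by rewrite coprime_sym prime_coprime.
have [u s us _] := egcdnP p j_gt0; have := bjM (i * u)%N.
by rewrite -mulnA us (eqP cjp) mulnDr muln1 addnC mulnA bpM.
Qed.

Section Metacyclic.
Local Open Scope ring_scope.
Variables (k : closedFieldType) (gT : finGroupType) (G : {group gT}) (n : nat).
Variables (rG : mx_representation k G n) (p q : nat) (z x : gT) (v : 'cV[k]_n).
Hypotheses (zG : z \in G) (xG : x \in G) (p_pr : prime p) (q_pr : prime q).
Hypotheses (neq_qp : q != p) (q0 : q%:R != 0 :> k) (oz : #[z]%g = q).
Hypotheses (p_x : p.-elt x) (nzx : x \in 'N(<[z]>)%g).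
Hypotheses (xp_z : commute (x ^+ p)%g z) (x_z : ~ commute x z) (v0 : v != 0).

Let N := <[x ^+ p]>%g.
Let L := (<[z]> <*> N)%G.
Let K := (<[z]> <*> <[x]>)%G.

Let coprime_zx : coprime #|<[z]>| #|<[x]>|.
Proof.
rewrite -!orderE oz; apply: pnat_coprime (pnat_id q_pr) _.
by apply: sub_in_pnat p_x => r _ /eqnP ->; rewrite inE /= inE eq_sym.
Qed.

Let order_x : #[x]%g = (p * #[x ^+ p]%g)%N.
Proof.
have dvdp : (p %| #[x])%N.
  have /p_natP[[|e] ox] := p_x; last by rewrite ox dvdn_exp.
  move/eqP: ox; rewrite expn0 order_eq1 => /eqP x1.
  by case: x_z; rewrite x1; exact: commute_sym (commute1 z).
by rewrite orderXdiv // mulnC divnK.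
Qed.

Let sNG : N \subset G. Proof. by rewrite cycle_subG groupX. Qed.
Let szG : <[z]>%g \subset G. Proof. by rewrite cycle_subG. Qed.
Let sxG : <[x]>%g \subset G. Proof. by rewrite cycle_subG. Qed.
Let sLG : L \subset G. Proof. by rewrite join_subG szG sNG. Qed.
Let sKG : K \subset G. Proof. by rewrite join_subG szG sxG. Qed.
Let sNx : N \subset <[x]>%g. Proof. exact: cycleX. Qed.
Let sLK : L \subset K. Proof. by rewrite genS // setUS. Qed.

Let card_L : #|L| = (q * #|N|)%N.
Proof.
rewrite /L /= cent_joinEr; last first.
  by rewrite cent_cycle cycle_subG; apply/cent1P.
rewrite coprime_cardMg -?orderE ?oz //.
by rewrite -oz orderE; apply: coprime_dvdr (cardSg sNx) coprime_zx.
Qed.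

Let card_K : #|K| = (p * (q * #|N|))%N.
Proof.
rewrite /K /= norm_joinEr ?cycle_subG // coprime_cardMg // -!orderE oz order_x.
by rewrite mulnCA.
Qed.

Let index_mul (M : {group gT}) (r d : nat) :
  M \subset G -> (0 < r)%N -> #|M| = (r * d)%N -> (#|G : M| * d)%N = (#|G| %/ r)%N.
Proof. by move=> sMG r0 oM; rewrite -(Lagrange sMG) oM -mulnA mulKn // mulnC. Qed.

Let eigen_ex : exists c w, [/\ fixes rG N c, (msize c <= #|N|.+1)%N, evalV c 0 = 0 &
  [/\ w ^+ q = 1, actp rG z c = w *: c & evalV c v != 0]].
Proof.
have [f [fN fd f0 fv]] := separated_order rG sNG v0.
pose W f := [/\ fixes rG N f, (msize f <= #|N|.+1)%N & evalV f 0 = 0].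
have W0 : W 0 by split=> [b _||]; rewrite ?actp0 ?msize0 ?/evalV ?meval0.
have WD u f1 f2 : W f1 -> W f2 -> W (u *: f1 + f2).
  move=> [f1N f1d f10] [f2N f2d f20]; split.
  - by move=> b bN; rewrite actpD actpZ f1N // f2N.
  - rewrite (leq_trans (msizeD_le _ _)) // geq_max f2d andbT.
    exact: leq_trans (msizeZ_le _ _) f1d.
  - by rewrite evalVD evalVZ f10 f20 mulr0 addr0.
have Wz f1 : W f1 -> W (actp rG z f1).
  move=> [f1N f1d f10]; split.
  - move=> b bN; have bG := subsetP sNG b bN.
    have bz : (b * z = z * b)%g.
      by have /cycleP[j ->] := bN; apply/commute_sym/commuteX/commute_sym.
    by rewrite -(actpM _ _ bG zG) bz (actpM _ _ zG bG) f1N.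
  - exact: leq_trans (msize_actp _ _ _) f1d.
  - by rewrite evalV_actp0.
have zqf : actp rG (z ^+ q)%g f = f by rewrite -oz expg_order actp1.
have [c [w [[cN cd c0] wq zc cv]]] := eigencomponent_ex zG q0 W0 WD Wz
  (And3 fN fd f0) zqf fv.
by exists c, w.
Qed.

(** Let c be an eigenvector of z for w, and c_i its translate by x ^ i, an
    eigenvector for w ^ (a ^ i), where z ^ x = z ^+ a. If w = 1 then c is
    invariant under L, and the index bound suffices. Otherwise the residues
    a ^ i are distinct modulo q for i < p, and only the set S of those i such
    that c_i(v) != 0 matters. If S contains all i < p, the product of the c_i is
    invariant under K. If not, take a product f of the c_i for i in S, each with
    a positive exponent, of total degree at most q and trivial weight: it is
    L-invariant, and its translates by elements of K outside L vanish at v, because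
    p is prime and so S is not stable under any nontrivial shift. *)
Lemma separated_metacyclic l :
  (0 < l)%N -> (l <= p)%N -> (l <= q)%N -> separated rG G (#|G| %/ l) v.
Proof.
move=> l_gt0 lp lq; have [c [w [cN cd c0 [wq zc cv]]]] := eigen_ex.
have [q_gt0 p_gt0] := (prime_gt0 q_pr, prime_gt0 p_pr).
have [w1|w1] := eqVneq w 1.
  apply: separated_leq (leq_div2l _ l_gt0 lq) _.
  rewrite -(index_mul sLG q_gt0 card_L); apply: separated_index sLG _.
  exists c; split=> //; apply: fixes_joing => //.
  by apply: fixes_cycle => //; rewrite zc w1 scale1r.
apply: separated_leq (leq_div2l _ l_gt0 lp) _.
rewrite -(index_mul sKG p_gt0 card_K); apply: separated_index sKG _.
have prim_w := prime_prim_root q_pr wq w1.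
have /cycleP[a za] : (z ^ x)%g \in <[z]>%g by rewrite memJ_norm ?cycle_id.
have zxi i : (z ^ (x ^+ i) = z ^+ (a ^ i))%g.
  elim: i => [|i IH]; first by rewrite expg0 conjg1 expn0 expg1.
  by rewrite expgSr conjgM IH conjXg za -expgM expnS mulnC mulnC.
pose al : 'F_q := a%:R.
have eq_F i j : (i%:R == j%:R :> 'F_q) = (i == j %[mod q])%N.
  by rewrite -val_eqE /= !val_Fp_nat.
have alp : al ^+ p = 1.
  apply/eqP; rewrite -natrX -[1]/(1%:R) eq_F -oz -eq_expg_mod_order.
  by rewrite -zxi conjgE -xp_z mulKg expg1.
have al1 : al != 1.
  rewrite -[1]/(1%:R) eq_F -oz -eq_expg_mod_order -za.
  apply/eqP => zx; apply: x_z; rewrite /commute.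
  by rewrite [RHS]conjgC zx expg1.
have prim_al := prime_prim_root p_pr alp al1.
pose ci i := actp rG (x ^+ i)%g c.
have xiG i : (x ^+ i)%g \in G by rewrite groupX.
have ci_x i j : actp rG (x ^+ j)%g (ci i) = ci (i + j)%N.
  by rewrite /ci -(actpM _ _ (xiG j) (xiG i)) -expgD addnC.
have ci_p i : ci (i + p)%N = ci i.
  by rewrite /ci expgD (actpM _ _ (xiG i) (xiG p)) cN ?cycle_id.
have ci_N i : fixes rG N (ci i).
  move=> b bN; have bG := subsetP sNG b bN.
  have bx : (b * x ^+ i = x ^+ i * b)%g.
    by have /cycleP[j ->] := bN; apply/commuteX/commute_sym/commuteX/commuteX.
  by rewrite /ci -(actpM _ _ bG (xiG i)) bx (actpM _ _ (xiG i) bG) cN.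
have ci_d i : (msize (ci i) <= #|N|.+1)%N by apply: leq_trans (msize_actp _ _ _) cd.
have ci_z i : actp rG z (ci i) = w ^+ (a ^ i) *: ci i.
  rewrite /ci -(actpM _ _ zG (xiG i)) conjgC zxi.
  rewrite (actpM _ _ (xiG i) (groupX _ zG)) -actpZ; congr (actp _ _ _).
  exact: actpX_eigen.
have ci0 i : evalV (ci i) 0 = 0 by rewrite evalV_actp0.
pose b i := evalV (ci i) v != 0.
have b0 : b 0 by rewrite /b /ci expg0 actp1.
pose S := [set i : 'I_p | b i].
(* a monomial whose weight is zero modulo q is fixed by z *)
have wsum (A : pred 'I_p) (m : 'I_p -> nat) :
    \sum_(i | A i) (al ^+ i) *+ m i = 0 ->
  \prod_(i | A i) (w ^+ (a ^ i)) ^+ m i = 1.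
  move=> sum0; under eq_bigr do rewrite -exprM.
  rewrite prodrXr -(expr0 w); apply/eqP; rewrite (eq_prim_root_expr prim_w) -eq_F.
  rewrite mulr0n -[X in _ == X]sum0 natr_sum; apply/eqP/eq_bigr => i _.
  by rewrite natrM natrX -[RHS]mulr_natr.
have alI : injective (fun i : 'I_p => al ^+ i).
  move=> i j /eqP; rewrite (eq_prim_root_expr prim_al) !modn_small //.
  by move/eqP/val_inj.
have [ST|SnT] := eqVneq S setT.
  exists (\prod_(i < p) ci i); split.
  - apply: fixes_joing => //; apply: fixes_cycle => //; rewrite actp_prod.
      rewrite (eq_bigr (fun i : 'I_p => w ^+ (a ^ i) *: ci i)) => [|i _]; last first.
        exact: ci_z.
      rewrite scaler_prod -[RHS]scale1r; congr (_ *: _).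
      by apply: (wsum predT (fun=> 1%N)); apply: sum_expr_unity.
    apply: etrans (big_cyclic_shift _ (ci_p 0)).
    by apply: eq_bigr => i _; rewrite -addn1 -ci_x expg1.
  - have cd' (i : 'I_p) : predT i -> (msize (ci i) <= #|N|.+1)%N by [].
    apply: leq_trans (msize_prod_le (index_enum _) cd') _.
    rewrite ltnS sum_nat_const card_ord leq_mul2r; apply/orP; right.
    by rewrite -(card_Fp q_pr) -[leqLHS]card_ord; apply: leq_card alI.
  - exact: (@evalV_prod_eq0 _ _ _ _ _ _ (Ordinal p_gt0) _ (ci0 0)).
  rewrite evalV_prod; apply/prodf_neq0 => i _.
  by have := in_setT i; rewrite -ST inE.
have Sn0 : S != set0 by apply/set0Pn; exists (Ordinal p_gt0); rewrite inE.
have al0 : {in S, forall i : 'I_p, al ^+ i != 0}.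
  move=> i _; apply/expf_neq0; apply: contra_eq_neq alp => ->.
  by rewrite expr0n eqn0Ngt p_gt0 eq_sym oner_eq0.
have [m [m_gt0 sm sum0]] := short_zero_sum q_pr Sn0 (in2W alI) al0.
pose f := \prod_(i in S) ci i ^+ m i.
have fL : fixes rG L f.
  apply: fixes_joing => //.
    apply: fixes_cycle => //; rewrite actp_prod.
    under eq_bigr do rewrite actpX ci_z exprZn.
    by rewrite scaler_prod wsum // scale1r.
  move=> g gN; rewrite actp_prod; apply: eq_bigr => i _.
  by rewrite actpX ci_N.
apply: (separated_isolated (rG := subg_repr rG sKG) (f := f) sLK).
- exact: fL.
- have cd' i : i \in S -> (msize (ci i ^+ m i) <= (m i * #|N|).+1)%N.
    by move=> _; apply: msizeX_le.
  apply: leq_trans (msize_prod_le (index_enum _) cd') _.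
  by rewrite ltnS -big_distrl leq_mul2r sm orbT.
- have /set0Pn[i iS] := Sn0.
  exact: evalV_prod_eq0 iS (evalVX_eq0 (m_gt0 i iS) (ci0 i)).
- rewrite evalV_prod; apply/prodf_neq0 => i; rewrite inE => bi.
  by rewrite evalVX expf_neq0.
move=> g; rewrite /K /= joingC norm_joinEl ?cycle_subG // => /mulsgP.
move=> [_ zi /cycleP[j ->] ziz -> xziL].
have ndvd : ~~ (p %| j)%N.
  apply: contra xziL => /dvdnP[s ->]; rewrite groupM //; last first.
    by rewrite mem_gen // inE ziz.
  by rewrite mem_gen // inE mulnC expgM mem_cycle orbT.
have zifix : actp rG zi f = f by apply: fL; rewrite mem_gen // inE ziz.
change (evalV (actp rG (x ^+ j * zi)%g f) v = 0).
rewrite (actpM _ _ (xiG j) (subsetP szG _ ziz)) zifix actp_prod.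
have [i iS nbij] : exists2 i : 'I_p, i \in S & ~~ b (i + j)%N.
  apply/exists_inP; apply: contraNT SnT; rewrite negb_exists_in => /forall_inP bS.
  have bp i : b (i + p)%N = b i by rewrite /b ci_p.
  have bj i : (i < p)%N -> b i -> b (i + j)%N.
    by move=> ltip; have := bS (Ordinal ltip); rewrite inE negbK; apply.
  apply/eqP/setP => i; rewrite !inE.
  exact: periodic_shift_closed p_pr ndvd bp b0 bj i.
apply: (evalV_prod_eq0 iS); rewrite actpX ci_x.
by apply: (evalVX_eq0 (m_gt0 i iS)); apply/eqP; rewrite negbK in nbij.
Qed.

End Metacyclic.

(** * Coprime action *)

Section CoprimeAction.
Variable gT : finGroupType.
Implicit Types (x y z : gT) (H Q : {group gT}).

(** If x centralised all its invariant Sylow subgroups, the order of the centraliser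
    of x in H would be divisible by every q-part of #|H|. *)
Lemma noncentral_Sylow_ex x H :
    x \in 'N(H) -> coprime #|H| #[x] -> x \notin 'C(H) ->
  exists q : nat, exists Q : {group gT},
    [/\ q.-Sylow(H) Q, x \in 'N(Q) & x \notin 'C(Q)].
Proof.
move=> nHx coHx; apply: contraPP => noQ; apply/negP; rewrite negbK.
have sol_x : solvable <[x]> by apply/abelian_sol/cycle_abelian.
have nHX : <[x]> \subset 'N(H) by rewrite cycle_subG.
have dvdC : #|H| %| #|'C_H[x]|.
  apply/dvdn_partP => // q _.
  have [Q sylQ nQX] := sol_coprime_Sylow_exists q sol_x nHX coHx.
  have [sQH _ _] := and3P sylQ.
  have cQx : Q \subset 'C[x].
    apply: contraT => ncQx; case: noQ; exists q, Q; split=> //.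
      by rewrite -cycle_subG.
    by rewrite -sub_cent1.
  by rewrite -(card_Hall sylQ) cardSg // subsetI sQH.
rewrite -sub_cent1; apply/setIidPl/eqP.
by rewrite eqEcard subsetIl dvdn_leq // cardG_gt0.
Qed.

(** A nontrivial commutator subgroup [~: Q, <[x]>] would contain the subgroup of
    order q of the cyclic group Q, but by coprimality it has no nontrivial
    element that x centralises. *)
Lemma noncentral_order_prime_ex (q : nat) x Q :
    q.-group Q -> cyclic Q -> x \in 'N(Q) -> coprime #|Q| #[x] -> x \notin 'C(Q) ->
  exists z, [/\ z \in Q, #[z] = q, x \in 'N(<[z]>) & x \notin 'C[z]].
Proof.
move=> qQ cycQ nQx coQx ncQx.
have ntQ : Q :!=: 1 by apply: contraNneq ncQx => ->; rewrite -sub_cent1 sub1G.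
have [q_pr dvdqQ _] := pgroup_pdiv qQ ntQ; have [z zQ oz] := Cauchy q_pr dvdqQ.
have szQ : <[z]> \subset Q by rewrite cycle_subG.
have nQX : <[x]> \subset 'N(Q) by rewrite cycle_subG.
have abQ := cyclic_abelian cycQ.
exists z; split=> //.
  have charz : <[z]> \char Q by rewrite sub_cyclic_char.
  by have := char_norm_trans charz nQX; rewrite cycle_subG.
apply: contra ncQx => /cent1P xz; pose R := [~: Q, <[x]> ]%G.
have sRQ : R \subset Q by rewrite commg_subl.
have [R1|ntR] := eqVneq (R : {set gT}) 1.
  by rewrite -cycle_subG centsC; apply/commG1P.
have zR : z \in R.
  rewrite -cycle_subG -(cardSg_cyclic cycQ) // -orderE oz.
  by have [_ ->] := pgroup_pdiv (pgroupS sRQ qQ) ntR.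
have : z \in 'C_R(<[x]>) by rewrite inE zR cent_cycle; apply/cent1P.
rewrite (coprime_abel_cent_TI nQX) -?orderE // => /set1P z1.
by have := prime_gt1 q_pr; rewrite -oz z1 order1.
Qed.

End CoprimeAction.

(** * Groups with a normal p-complement *)

Lemma last_noncommuting_power (gT : finGroupType) (p : nat) (x z : gT) :
    p.-elt x -> x \notin 'C[z] ->
  exists i, x ^+ i \notin 'C[z] /\ x ^+ i ^+ p \in 'C[z].
Proof.
move=> p_x ncx; have ex_j : exists j, x ^+ (p ^ j) \in 'C[z].
  by have /p_natP[e oe] := p_x; exists e; rewrite -oe expg_order group1.
case: (ex_minnP ex_j) => [[|j]] cj min_j.
  by rewrite expn0 expg1 (negbTE ncx) in cj.
exists (p ^ j)%N; split; last by rewrite -expgM -expnSr.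
by apply/negP => /min_j; rewrite ltnn.
Qed.

Section NormalComplement.
Variables (k : closedFieldType) (gT : finGroupType) (p : nat) (G P H : {group gT}).
Hypotheses (pk : p \in [pchar k]%R) (sylP : p.-Sylow(G) P) (nsHG : H <| G).
Hypotheses (defG : (P * H)%g = G) (tiPH : P :&: H = 1%g).

Let p'H : p^'.-group H.
Proof.
have [sPG _] := and3P sylP; rewrite /pgroup -(_ : #|G : P| = #|H|) //.
by rewrite -divgS // -defG (TI_cardMg tiPH) mulKn.
Qed.

Lemma complement_noncentral : ~~ (P <| G) -> exists2 x, x \in P & x \notin 'C(H).
Proof.
move=> nnPG; apply/subsetPn; apply: contra nnPG => cPH.
rewrite /normal (pHall_sub sylP) -{1}defG mulG_subG normG.
by rewrite cents_norm // centsC.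
Qed.

Lemma sigma_leq_normal_complement :
  ~~ (P <| G) -> (sigma k G <= #|G| %/ pdiv #|G|)%N.
Proof.
move=> nnPG; apply: sigma_leq => n rG v v0.
have [sHG nHG] := andP nsHG; have [sPG pP _] := and3P sylP.
have [x xP ncHx] := complement_noncentral nnPG; have xG := subsetP sPG x xP.
have p_x : p.-elt x := mem_p_elt pP xP.
have coHx : coprime #|H| #[x] by rewrite coprime_sym; apply: pnat_coprime p_x p'H.
have [q [Q [sylQ nQx ncQx]]] := noncentral_Sylow_ex (subsetP nHG x xG) coHx ncHx.
have [sQH qQ _] := and3P sylQ; have sQG := subset_trans sQH sHG.
have ntQ : Q :!=: 1 by apply: contraNneq ncQx => ->; rewrite -sub_cent1 sub1G.
have [q_pr dvdqQ _] := pgroup_pdiv qQ ntQ; have p_pr := pcharf_prime pk.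
have neq_qp : q != p.
  have := pnatPpi (pgroupS sQH p'H) (_ : q \in \pi(Q)).
  by rewrite mem_primes q_pr cardG_gt0 dvdqQ; apply.
have q0 : (q%:R != 0 :> k)%R.
  by rewrite -(dvdn_pcharf pk) dvdn_prime2 // eq_sym.
have lq : (pdiv #|G| <= q)%N.
  by rewrite pdiv_min_dvd ?prime_gt1 // (dvdn_trans dvdqQ) ?cardSg.
have [cycQ|ncycQ] := boolP (cyclic Q); last first.
  have sepQ := separated_noncyclic rG sQG qQ q0 ncycQ v0.
  apply: separated_leq (separated_index sQG sepQ).
  rewrite muln_divA // mulnC Lagrange //.
  by rewrite leq_div2l ?pdiv_gt0.
have coQx : coprime #|Q| #[x] := coprime_dvdl (cardSg sQH) coHx.
have [z [zQ oz nzx nczx]] := noncentral_order_prime_ex qQ cycQ nQx coQx ncQx.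
have [i [nci cip]] := last_noncommuting_power p_x nczx.
have dvdpG : (p %| #|G|)%N.
  have ntP : P :!=: 1.
    by apply: contraNneq ncHx => P1; move: xP; rewrite P1 => /set1P ->; apply: group1.
  by have [_ dvdpP _] := pgroup_pdiv pP ntP; apply: dvdn_trans dvdpP (cardSg sPG).
apply: (separated_metacyclic rG (subsetP sQG z zQ) (groupX i xG) p_pr q_pr neq_qp q0 oz).
- exact: mem_p_elt pP (groupX i xP).
- exact: groupX.
- exact/cent1P.
- by move/cent1P; apply/negP.
- by [].
- exact: pdiv_gt0.
- by rewrite pdiv_min_dvd ?prime_gt1.
- by [].
Qed.

End NormalComplement.

Theorem theorem1p3 (k : closedFieldType) (p : nat) (gT : finGroupType)
    (G P : {group gT}) :
  p \in [pchar k]%R ->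
  (p %| #|G|)%N ->
  p.-Sylow(G) P ->
  [/\ (sigma k G = #|G| ->
        cyclic ('N_G(P) / P) /\
        (abelian P -> G :!=: P -> 'N_G(P) / P != 1)),
      ((cyclic ('N_G(P) / P) -> (#|'N_G(P)| <= sigma k G)%N) /\
       (P <| G -> cyclic (G / P) -> sigma k G = #|G|))
    & (p_nilpotent p G -> ~~ (P <| G) ->
        (sigma k G <= #|G| %/ pdiv #|G|)%N)].
Proof.
move=> pk _ sylP; split.
- move=> /(sigma_eq_order pk sylP)[nsPG cycGP].
  have [sPG nPG] := andP nsPG; rewrite (setIidPl nPG); split=> // _.
  apply: contraNN; rewrite -subG1 quotient_sub1 // => sGP.
  by rewrite eqEsubset sGP sPG.
- have sPN : P \subset 'N_G(P) by rewrite subsetI (pHall_sub sylP) normG.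
  have sylPN := pHall_subl sPN (subsetIl _ _) sylP.
  have nsPN : P <| 'N_G(P) by rewrite normal_subnorm (pHall_sub sylP).
  split=> [cycN|nsPG cycGP].
    exact: sigma_geq_cyclic_quotient pk sylPN nsPN (subsetIl _ _) cycN.
  apply/eqP; rewrite eqn_leq sigma_leq_order.
  exact: sigma_geq_cyclic_quotient pk sylP nsPG (subxx _) cycGP.
move=> [P1 [H [sylP1 nsHG defG tiPH]]] nnPG.
apply: (sigma_leq_normal_complement pk sylP1 nsHG defG tiPH).
apply: contra nnPG => nsP1G; have [y yG ->] := Sylow_trans sylP1 sylP.
by rewrite (normP _) // (subsetP (normal_norm nsP1G)).
Qed.
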